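(* Let $n,n_1\ge 1$, let $\hat{x}_{k+1|k}\in\mathbb{R}^n$, let $P_{k+1|k}\in\mathbb{R}^{n\times n}$ and $R_{k+1}\in\mathbb{R}^{n_1\times n_1}$ be symmetric positive definite, and let $E_{k+1|k}$ be the Cholesky factor of $P_{k+1|k}$, $P_{k+1|k}=E_{k+1|k}E_{k+1|k}^T$. Let $h_{k+1}:\mathbb{R}^n\to\mathbb{R}^{n_1}$ be differentiable at $\hat{x}_{k+1|k}$ with Jacobian matrix $J_{h_{k+1|k}}$ there. Let $\mathcal{E}_{h_{k+1}}$ be an ellipsoid with center $e_{h_{k+1}}\in\mathbb{R}^{n_1}$ and symmetric positive definite shape matrix $P_{h_{k+1}}=B_{h_{k+1}}B_{h_{k+1}}^T$, $B_{h_{k+1}}\in\mathbb{R}^{n_1\times n_1}$, such that for all $u\in\mathbb{R}^n$ with $\|u\|\le 1$, $$h_{k+1}(\hat{x}_{k+1|k}+E_{k+1|k}u)-h_{k+1}(\hat{x}_{k+1|k})-J_{h_{k+1|k}}E_{k+1|k}u\in\mathcal{E}_{h_{k+1}}.$$ Let $y_{k+1}\in\mathbb{R}^{n_1}$ be given. For $\hat{x}_{k+1}\in\mathbb{R}^n$ define the block matrices $$\Phi_{k+1}(\hat{x}_{k+1})=[\,\hat{x}_{k+1|k}-\hat{x}_{k+1},\;E_{k+1|k},\;0,\;0\,],$$ $$\Psi_{k+1}(y_{k+1})=[\,h_{k+1}(\hat{x}_{k+1|k})+e_{h_{k+1}}-y_{k+1},\;J_{h_{k+1|k}}E_{k+1|k},\;I,\;B_{h_{k+1}}\,],$$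 whose column blocks have widths $1,n,n_1,n_1$, and let $(\Psi_{k+1}(y_{k+1}))_\perp$ be an orthogonal complement of $\Psi_{k+1}(y_{k+1})$. For real $\tau^u,\tau^v,\tau^h$ let $$\Xi=\operatorname{diag}(1-\tau^u-\tau^v-\tau^h,\;\tau^uI,\;\tau^vR_{k+1}^{-1},\;\tau^hI).$$ Let $f$ be a real-valued size function of the shape matrix (e.g. $f(P)=\operatorname{tr}(P)$ or $f(P)=\log\det(P)$). Suppose $P_{k+1}$ (symmetric $n\times n$), $\hat{x}_{k+1}$, $\tau^u,\tau^v,\tau^h$ solve the optimization problem $$\min\ f(P_{k+1})\quad\text{subject to}\quad \tau^u,\tau^v,\tau^h\ge 0,\quad -P_{k+1}\prec 0,$$ $$\begin{bmatrix}-P_{k+1} & \Phi_{k+1}(\hat{x}_{k+1})(\Psi_{k+1}(y_{k+1}))_\perp\\ (\Phi_{k+1}(\hat{x}_{k+1})(\Psi_{k+1}(y_{k+1}))_\perp)^T & -(\Psi_{k+1}(y_{k+1}))_\perp^T\,\Xi\,(\Psi_{k+1}(y_{k+1}))_\perp\end{bmatrix}\preceq 0 .$$ Then $\mathcal{E}_{k+1}=\{x\in\mathbb{R}^n:(x-\hat{x}_{k+1})^TP_{k+1}^{-1}(x-\hat{x}_{k+1})\le 1\}$ is a bounding ellipsoid for the state: for all $x_{k+1}\in\mathbb{R}^n$ and $v_{k+1}\in\mathbb{R}^{n_1}$ with $(x_{k+1}-\hat{x}_{k+1|k})^TP_{k+1|k}^{-1}(x_{k+1}-\hat{x}_{k+1|k})\le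 1$, $v_{k+1}^TR_{k+1}^{-1}v_{k+1}\le 1$ and $y_{k+1}=h_{k+1}(x_{k+1})+v_{k+1}$, one has $x_{k+1}\in\mathcal{E}_{k+1}$.
   Context: The setting is the measurement equation $y_{k+1}=h_{k+1}(x_{k+1})+v_{k+1}$ of a nonlinear dynamic system with state $x_{k+1}\in\mathbb{R}^n$, measurement $y_{k+1}\in\mathbb{R}^{n_1}$ and unknown but bounded measurement noise $v_{k+1}$; the state is already known to lie in the predicted ellipsoid $\mathcal{E}_{k+1|k}$ with center $\hat{x}_{k+1|k}$ and shape matrix $P_{k+1|k}$. The ellipsoid with center $e\in\mathbb{R}^m$ and symmetric positive definite shape matrix $P=BB^T$ is $\{x\in\mathbb{R}^m:(x-e)^TP^{-1}(x-e)\le 1\}=\{e+B\Delta:\Delta\in\mathbb{R}^m,\ \|\Delta\|\le 1\}$, with $\|\cdot\|$ the Euclidean norm. An orthogonal complement $\Psi_\perp$ of a matrix $\Psi$ is a matrix whose columns form a basis of the null space $\{\xi:\Psi\xi=0\}$. $A\prec 0$ (resp. $A\preceq 0$) means that the symmetric matrix $A$ is negative definite (resp. negative semidefinite). $\operatorname{diag}$ denotes a block-diagonal matrix; $I$ and $0$ are identity and zero blocks of compatible dimensions. *)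

(* Defs.v *)
From HB Require Import structures.
From mathcomp Require Export all_boot all_order all_algebra.
From mathcomp Require Export all_classical all_reals all_analysis.
Export Order.TTheory GRing.Theory Num.Theory.
Export numFieldNormedType.Exports.

Set Implicit Arguments.
Unset Strict Implicit.
Unset Printing Implicit Defensive.

Local Open Scope classical_set_scope.
Local Open Scope ring_scope.

Section MatrixNotions.
Context {R : realType}.

Definition quadform m (A : 'M[R]_m) (x : 'cV[R]_m) : R :=
  (x^T *m A *m x) 0 0.

Definition posdefmx m (A : 'M[R]_m) : Prop :=
  A^T = A /\ forall x : 'cV[R]_m, x != 0 -> 0 < quadform A x.

Definition negdefmx m (A : 'M[R]_m) : Prop :=
  A^T = A /\ forall x : 'cV[R]_m, x != 0 -> quadform A x < 0.

Definition negsemidefmx m (A : 'M[R]_m) : Prop :=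
  A^T = A /\ forall x : 'cV[R]_m, quadform A x <= 0.

(* The norm `|x| that the library puts on matrices is the sup norm, hence this
   separate definition. *)
Definition eucl_norm m (x : 'cV[R]_m) : R := Num.sqrt (\sum_i x i 0 ^+ 2).

(* Only meaningful as an ellipsoid when P is symmetric positive definite. *)
Definition ellipsoid m (e : 'cV[R]_m) (P : 'M[R]_m) : set 'cV[R]_m :=
  [set x | quadform (invmx P) (x - e) <= 1].

(* is_trig_mx means lower triangular. *)
Definition is_cholesky_factor m (P E : 'M[R]_m) : Prop :=
  [/\ is_trig_mx E, forall i, 0 < E i i & P = E *m E^T].

(* Library kernels and bases are made of row vectors, hence the transposes: the
   columns of Q are linearly independent and span {xi | Psi *m xi = 0}. *)
Definition is_orth_complement m p q (Psi : 'M[R]_(m, p)) (Q : 'M[R]_(p, q)) :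
    Prop :=
  row_free Q^T /\ (Q^T == kermx Psi^T)%MS.

(* The library's [jacobian] is for maps between row vectors and is the transpose
   of the usual Jacobian matrix (d h_i / d x_j)_(i, j) used here. *)
Definition jacobian_col n m (h : 'cV[R]_n -> 'cV[R]_m) (a : 'cV[R]_n) :
    'M[R]_(m, n) :=
  \matrix_(i, j) 'D_(delta_mx j 0) (fun x => h x i 0) a.

End MatrixNotions.

Section MeasurementUpdate.
Context {R : realType} {n n1 : nat}.

Definition Phi_mx (xpred : 'cV[R]_n) (E : 'M[R]_n) (xhat : 'cV[R]_n) :
    'M[R]_(n, 1 + (n + (n1 + n1))) :=
  row_mx (xpred - xhat) (row_mx E (row_mx 0 0)).

Definition Psi_mx (h : 'cV[R]_n -> 'cV[R]_n1) (xpred : 'cV[R]_n)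
    (E : 'M[R]_n) (eh : 'cV[R]_n1) (Bh : 'M[R]_n1) (y : 'cV[R]_n1) :
    'M[R]_(n1, 1 + (n + (n1 + n1))) :=
  row_mx (h xpred + eh - y)
    (row_mx (jacobian_col h xpred *m E) (row_mx 1%:M Bh)).

Definition Xi_mx (Rv : 'M[R]_n1) (tu tv th : R) :
    'M[R]_(1 + (n + (n1 + n1))) :=
  block_mx (1 - tu - tv - th)%:M 0
           0 (block_mx tu%:M 0
                       0 (block_mx (tv *: invmx Rv) 0
                                   0 th%:M)).

Definition lmi_mx q (P : 'M[R]_n) (Phi : 'M[R]_(n, 1 + (n + (n1 + n1))))
    (Q : 'M[R]_(1 + (n + (n1 + n1)), q))
    (Xi : 'M[R]_(1 + (n + (n1 + n1)))) : 'M[R]_(n + q) :=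
  block_mx (- P)          (Phi *m Q)
           (Phi *m Q)^T   (- (Q^T *m Xi *m Q)).

Definition feasible q (xpred : 'cV[R]_n) (E : 'M[R]_n) (Rv : 'M[R]_n1)
    (Q : 'M[R]_(1 + (n + (n1 + n1)), q))
    (P : 'M[R]_n) (xhat : 'cV[R]_n) (tu tv th : R) : Prop :=
  [/\ [/\ 0 <= tu, 0 <= tv & 0 <= th],
      negdefmx (- P) &
      negsemidefmx (lmi_mx P (Phi_mx xpred E xhat) Q (Xi_mx Rv tu tv th))].

(* The size function f is a total function on matrices; only its values at
   positive definite matrices matter. *)
Definition solves q (f : 'M[R]_n -> R) (xpred : 'cV[R]_n) (E : 'M[R]_n)
    (Rv : 'M[R]_n1) (Q : 'M[R]_(1 + (n + (n1 + n1)), q))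
    (P : 'M[R]_n) (xhat : 'cV[R]_n) (tu tv th : R) : Prop :=
  feasible xpred E Rv Q P xhat tu tv th /\
  forall (P' : 'M[R]_n) (xhat' : 'cV[R]_n) (tu' tv' th' : R),
    feasible xpred E Rv Q P' xhat' tu' tv' th' -> f P <= f P'.

End MeasurementUpdate.

(* Main.v *)
(** Put [xi = (1, u, v, Delta)] where [x = xpred + E u] and the remainder of [h]
    is [eh + Bh Delta]. The measurement equation says [Psi xi = 0], so
    [xi = Q z] for some [z], while [Phi xi = x - xhat] and [xi^T Xi xi <= 1].
    Writing [d = x - xhat], evaluating the matrix inequality at
    [(P^-1 d, z)] gives [d^T P^-1 d <= xi^T Xi xi <= 1]. *)

From mathcomp Require Import ring lra.
Require Import Defs.

Set Implicit Arguments.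
Unset Strict Implicit.
Unset Printing Implicit Defensive.

Local Open Scope classical_set_scope.
Local Open Scope ring_scope.

Section QuadraticForms.
Context {R : realType}.

Lemma quadformN m (A : 'M[R]_m) x : quadform (- A) x = - quadform A x.
Proof. by rewrite /quadform mulmxN mulNmx mxE. Qed.

Lemma quadformZ m a (A : 'M[R]_m) x : quadform (a *: A) x = a * quadform A x.
Proof. by rewrite /quadform -scalemxAr -scalemxAl mxE. Qed.

Lemma quadform_congr m p (A : 'M[R]_m) (B : 'M[R]_(m, p)) x :
  quadform (B^T *m A *m B) x = quadform A (B *m x).
Proof. by rewrite /quadform trmx_mul !mulmxA. Qed.

Lemma quadform_block m p (A : 'M[R]_m) (B : 'M[R]_(m, p)) (D : 'M[R]_p) x y :
  quadform (block_mx A B B^T D) (col_mx x y) =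
  quadform A x + (x^T *m (B *m y)) 0 0 *+ 2 + quadform D y.
Proof.
have addE (a b : 'M[R]_1) : (a + b) 0 0 = a 0 0 + b 0 0 by rewrite mxE.
rewrite /quadform tr_col_mx mul_row_block mul_row_col !mulmxDl !addE.
(* The two cross terms are transposes of each other, and a 1 by 1 matrix equals its transpose. *)
have -> : (y^T *m B^T *m x) 0 0 = (x^T *m (B *m y)) 0 0.
  by rewrite -[x in LHS]trmxK -!trmx_mul mxE.
by rewrite mulmxA; ring.
Qed.

Lemma quadform_diag m p (A : 'M[R]_m) (D : 'M[R]_p) x y :
  quadform (block_mx A 0 0 D) (col_mx x y) = quadform A x + quadform D y.
Proof.
(* Reading the lower left zero block as [0^T] gives the symmetric shape that [quadform_block]
   expects. *)
by rewrite -[X in block_mx _ _ X]trmx0 quadform_block mul0mx mulmx0 mxE mul0rn addr0.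
Qed.

Lemma quadform1 m (x : 'cV[R]_m) : quadform 1%:M x = \sum_i x i 0 ^+ 2.
Proof.
by rewrite /quadform mulmx1 mxE; apply: eq_bigr => i _; rewrite mxE expr2.
Qed.

Lemma quadform_scalar m a (x : 'cV[R]_m) :
  quadform a%:M x = a * quadform 1%:M x.
Proof. by rewrite -quadformZ scalemx1. Qed.

Lemma eucl_norm_le1 m (x : 'cV[R]_m) : (eucl_norm x <= 1) = (quadform 1%:M x <= 1).
Proof. by rewrite quadform1 /eucl_norm -[X in _ <= X]sqrtr1 ler_sqrt. Qed.

(** A nonzero kernel vector would make the quadratic form vanish. *)
Lemma posdefmx_unit m (A : 'M[R]_m) : posdefmx A -> A \in unitmx.
Proof.
case=> _ Apos; rewrite -unitmx_tr -row_free_unit.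
apply: inj_row_free => w wA0; apply: contraTeq isT => w0.
have := Apos w^T; rewrite trmx_eq0 => /(_ w0).
by rewrite /quadform -mulmxA -[A]trmxK -trmx_mul wA0 trmx0 mulmx0 mxE ltxx.
Qed.

(** This passes from the inequality form of an ellipsoid to its parametrization by the unit ball:
    the coordinate of [x] is [invmx B *m x]. *)
Lemma quadform_invmx_gram m (B : 'M[R]_m) x : B \in unitmx ->
  quadform (invmx (B *m B^T)) x = quadform 1%:M (invmx B *m x).
Proof.
move=> Bu; rewrite -quadform_congr mulmx1; congr quadform.
have BTu : B^T \in unitmx by rewrite unitmx_tr.
have BBu : B *m B^T \in unitmx by rewrite unitmx_mul Bu.
apply: (can_inj (mulKmx BBu)); rewrite mulmxV // -mulmxA (mulmxA B^T).
by rewrite trmx_inv mulmxV // mul1mx mulmxV.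
Qed.

Lemma orth_complement_im m p q (Psi : 'M[R]_(m, p)) (Q : 'M[R]_(p, q)) xi :
  is_orth_complement Psi Q -> Psi *m xi = 0 -> exists z : 'cV_q, xi = Q *m z.
Proof.
case=> _ /eqmxP QK xi0; have : (xi^T <= Q^T)%MS.
  by rewrite QK; apply/sub_kermxP; rewrite -trmx_mul xi0 trmx0.
case/submxP => w xiE; exists w^T.
by rewrite -[xi]trmxK xiE trmx_mul trmxK.
Qed.

(** One direction of the Schur complement argument. For fixed [z], the block form is a concave
    quadratic in its first argument, and [P^-1 d] with [d = Phi Q z] is its maximizer. *)
Lemma lmi_quadform_le n q p (P : 'M[R]_n) (Phi : 'M[R]_(n, p))
    (Q : 'M[R]_(p, q)) (Xi : 'M[R]_p) z :
  posdefmx P ->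
  negsemidefmx (block_mx (- P) (Phi *m Q) (Phi *m Q)^T (- (Q^T *m Xi *m Q))) ->
  quadform (invmx P) (Phi *m (Q *m z)) <= quadform Xi (Q *m z).
Proof.
move=> Ppd [_ /(_ (col_mx (invmx P *m (Phi *m (Q *m z))) z))].
have Pu := posdefmx_unit Ppd; have [PT _] := Ppd.
rewrite quadform_block !quadformN quadform_congr -(mulmxA Phi).
set d := Phi *m _.
have PVT : (invmx P)^T = invmx P by rewrite trmx_inv PT.
(* With [s = d^T P^-1 d], the three terms become [- s], [2 s] and minus the [Xi] form at [Q z]. *)
rewrite -(quadform_congr P (invmx P)) PVT mulVmx // mul1mx trmx_mul PVT.
rewrite -/(quadform (invmx P) d) mulr2n; lra.
Qed.

End QuadraticForms.

Theorem theorem3p2 (R : realType) (n n1 q : nat)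
  (n_ge1 : (1 <= n)%N) (n1_ge1 : (1 <= n1)%N)
  (xpred : 'cV[R]_n) (Ppred : 'M[R]_n) (Rv : 'M[R]_n1) (E : 'M[R]_n)
  (Ppred_pd : posdefmx Ppred) (Rv_pd : posdefmx Rv)
  (E_chol : is_cholesky_factor Ppred E)
  (h : 'cV[R]_n -> 'cV[R]_n1) (h_diff : differentiable h xpred)
  (eh : 'cV[R]_n1) (Ph Bh : 'M[R]_n1)
  (Ph_pd : posdefmx Ph) (Ph_fact : Ph = Bh *m Bh^T)
  (remainder_bound : forall u : 'cV[R]_n, eucl_norm u <= 1 ->
     ellipsoid eh Ph
       (h (xpred + E *m u) - h xpred - jacobian_col h xpred *m E *m u))
  (y : 'cV[R]_n1)
  (Q : 'M[R]_(1 + (n + (n1 + n1)), q))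
  (Q_orth : is_orth_complement (Psi_mx h xpred E eh Bh y) Q)
  (f : 'M[R]_n -> R)
  (P : 'M[R]_n) (xhat : 'cV[R]_n) (tu tv th : R)
  (opt : solves f xpred E Rv Q P xhat tu tv th) :
  forall (x : 'cV[R]_n) (v : 'cV[R]_n1),
    ellipsoid xpred Ppred x -> quadform (invmx Rv) v <= 1 -> y = h x + v ->
    ellipsoid xhat P x.
Proof.
move=> x v xin vle yE.
have [[[tu0 tv0 th0] [PT Ppos] lmi] _] := opt.
have Ppd : posdefmx P.
  split=> [|w w0]; first by apply: oppr_inj; rewrite -[LHS]linearN.
  by have := Ppos w w0; rewrite quadformN oppr_lt0.
have [_ _ PpredE] := E_chol.
have Eu : E \in unitmx.
  (* Square factors of an invertible product are invertible; the same argument serves for [Bh]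
     below. *)
  by have := posdefmx_unit Ppred_pd; rewrite PpredE unitmx_mul => /andP[].
have Bu : Bh \in unitmx.
  by have := posdefmx_unit Ph_pd; rewrite Ph_fact unitmx_mul => /andP[].
pose u := invmx E *m (x - xpred).
have xE : x = xpred + E *m u by rewrite mulKVmx // addrC subrK.
have ule : quadform 1%:M u <= 1.
  by rewrite -quadform_invmx_gram // -PpredE.
have := remainder_bound u; rewrite eucl_norm_le1 => /(_ ule).
rewrite /ellipsoid /= -xE Ph_fact quadform_invmx_gram //.
(* [D] is the unit-ball coordinate of the remainder of [h] at [u], relative to the center [eh]. *)
set r := _ - eh; set D := invmx Bh *m r => Dle.
have BD : Bh *m D = r by rewrite mulKVmx.
pose xi : 'cV[R]_(1 + (n + (n1 + n1))) :=
  col_mx 1%:M (col_mx u (col_mx v D)).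
have Psi0 : Psi_mx h xpred E eh Bh y *m xi = 0.
  (* The product is [h xpred + eh - y + J E u + v + Bh D]; it cancels once [y] becomes [h x + v] and
     [Bh D] becomes [r]. *)
  rewrite !mul_row_col mulmx1 mul1mx BD yE /r.
  by apply/matrixP => i j; rewrite !mxE; ring.
have PhiE : Phi_mx xpred E xhat *m xi = x - xhat.
  rewrite !mul_row_col mulmx1 !mul0mx !addr0 [in RHS]xE.
  by rewrite addrAC.
(* The S-procedure: the form equals 1 minus each multiplier times the slack of its constraint,
   [1 - |u|^2], [1 - v^T Rv^-1 v] or [1 - |D|^2]. *)
have XiE : quadform (Xi_mx Rv tu tv th) xi <= 1.
  rewrite quadform_diag (quadform_diag tu%:M) (quadform_diag (tv *: _)).
  rewrite quadformZ (quadform_scalar _ u) (quadform_scalar _ D).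
  have -> : quadform (1 - tu - tv - th)%:M (1%:M : 'cV[R]_1) = 1 - tu - tv - th.
    by rewrite /quadform trmx1 mul1mx mulmx1 mxE eqxx mulr1n.
  have := ler_wpM2l tu0 ule; have := ler_wpM2l tv0 vle.
  have := ler_wpM2l th0 Dle; lra.
have [z xiE] := orth_complement_im Q_orth Psi0.
apply: le_trans XiE; rewrite -PhiE xiE.
exact: lmi_quadform_le.
Qed.
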